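(* Let $f \colon A^n \to B$, and assume that $n > \max(|A|, 3)$ and $f$ is determined by $\operatorname{oddsupp}$. Then the function $f$ is reconstructible.
   Context: $A$ and $B$ are sets with at least two elements; $n$ is a positive integer. $[n] := \{1,\dots,n\}$, $\binom{[n]}{2}$ denotes the set of all $2$-element subsets of $[n]$, and $\Sigma_n$ is the symmetric group on $[n]$. For $\mathbf{a} \in A^n$ and $\sigma \colon [m] \to [n]$, write $\mathbf{a}\sigma := (a_{\sigma(1)},\dots,a_{\sigma(m)}) \in A^m$. Functions $f, g \colon A^n \to B$ are equivalent, $f \equiv g$, if there is $\sigma \in \Sigma_n$ with $f(\mathbf{a}) = g(\mathbf{a}\sigma)$ for all $\mathbf{a} \in A^n$. For $n \geq 2$, $f \colon A^n \to B$ and $I \in \binom{[n]}{2}$, the identification minor $f_I \colon A^{n-1} \to B$ is given by $f_I(\mathbf{a}) = f(\mathbf{a}\delta_I)$, where $\delta_I \colon [n] \to [n-1]$ is defined by $\delta_I(i) = i$ if $i < \max I$, $\delta_I(i) = \min I$ if $i = \max I$, and $\delta_I(i) = i-1$ if $i > \max I$. The deck of $f$, $\operatorname{deck} f$, is the multiset $\{f_I/{\equiv} : I \in \binom{[n]}{2}\}$ of equivalence classes. A function $g \colon A^n \to B$ is a reconstruction of $f$ if $\operatorname{deck} f = \operatorname{deck} g$. The function $f$ is reconstructible if it is equivalent to all of its reconstructions. $\mathcal{P}(A)$ is the power set of $A$ and $\operatorname{oddsupp}(a_1,\dots,a_n) := \{a \in A : |\{i \in [n] : a_i = a\}| \text{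 is odd}\}$. A function $f \colon A^n \to B$ is determined by $\operatorname{oddsupp}$ if there exists $f^* \colon \mathcal{P}(A) \to B$ such that $f = f^* \circ \operatorname{oddsupp}|_{A^n}$. *)

(* Defs.v *)
From mathcomp Require Export all_boot perm finmap multiset.
From mathcomp Require Import zify boolp classical_sets.

Set Implicit Arguments.
Unset Strict Implicit.
Unset Printing Implicit Defensive.

(* The index set [n] = {1, ..., n} is rendered by 'I_n = {0, ..., n-1}, and an
   n-tuple over A by the finite function type A ^ n = {ffun 'I_n -> A}.  The set
   A is a finType, because the results here assume |A| < n; B is any type. *)

Definition reindex (A : Type) (m n : nat) (a : (A ^ n)%type)
    (s : 'I_m -> 'I_n) : (A ^ m)%type :=
  [ffun i => a (s i)].

Definition fequiv (A B : Type) (n : nat) (f g : (A ^ n)%type -> B) : Prop :=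
  exists s : 'S_n, forall a : (A ^ n)%type, f a = g (reindex a s).

Definition fclass (A B : Type) (n : nat) (f : (A ^ n)%type -> B) :
    set ((A ^ n)%type -> B) :=
  [set g | fequiv f g]%classic.

Definition pair_of (n : nat) := {I : {set 'I_n} | #|I| == 2}.

Section Delta.
Variables (n : nat) (I : pair_of n).

(* The default value n of the minimum is never attained, as I is nonempty. *)
Definition min_pair : nat := \big[minn/n]_(i in val I) (i : nat).
Definition max_pair : nat := \max_(i in val I) (i : nat).

(* The formula is invariant under the shift between {1, ..., n} and
   {0, ..., n-1}. *)
Definition delta_nat (i : nat) : nat :=
  if i < max_pair then i
  else if i == max_pair then min_pair
  else i.-1.

Lemma pair_ofP : exists i j : 'I_n,
  [/\ i < j, val I = [set i; j]%SET, min_pair = i & max_pair = j].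
Proof.
have [x [y [xy IE]]] : exists x y : 'I_n, x != y /\ val I = [set x; y]%SET.
  by have /cards2P[x [y [xy IE]]] := valP I; exists x, y.
wlog lt_xy : x y xy IE / x < y => [hw|].
  case: (ltngtP x y) => [|yx|/val_inj xEy]; first exact: hw.
    by apply: (hw y x) => //; rewrite 1?eq_sym // IE finset.setUC.
  by rewrite xEy eqxx in xy.
exists x, y; split=> //.
  apply/eqP; rewrite eqn_leq /min_pair IE; apply/andP; split.
    elim: (index_enum _) (mem_index_enum x) => //= z s IHs.
    rewrite inE big_cons => /orP[/eqP <-|/IHs {}IHs].
      by rewrite !inE eqxx geq_minl.
    by case: ifP => // _; rewrite geq_min IHs orbT.
  elim/big_ind: _ => [|p q px qx|z]; first exact: ltnW.
    by rewrite leq_min px.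
  by rewrite !inE => /orP[] /eqP-> //; apply: ltnW.
rewrite /max_pair IE big_setU1 ?inE //= big_set1.
by apply/maxn_idPr/ltnW.
Qed.

Lemma delta_subproof (i : 'I_n) : delta_nat i < n.-1.
Proof.
have [x [y [xy _ mE ME]]] := pair_ofP; rewrite /delta_nat mE ME.
have iN := ltn_ord i; have yN := ltn_ord y.
by case: (ltngtP i y) => ?; lia.
Qed.

Definition delta (i : 'I_n) : 'I_n.-1 := Ordinal (delta_subproof i).

End Delta.

Definition minor (A B : Type) (n : nat) (f : (A ^ n)%type -> B)
    (I : pair_of n) : (A ^ n.-1)%type -> B :=
  fun a => f (reindex a (delta I)).

Definition deck (A B : Type) (n : nat) (f : (A ^ n)%type -> B) :
    {mset (set ((A ^ n.-1)%type -> B))}%mset :=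
  seq_mset [seq fclass (minor f J) | J : pair_of n].

Definition is_reconstruction (A B : Type) (n : nat)
    (g f : (A ^ n)%type -> B) : Prop :=
  deck f = deck g.

Definition reconstructible (A B : Type) (n : nat) (f : (A ^ n)%type -> B) :
    Prop :=
  forall g : (A ^ n)%type -> B, is_reconstruction g f -> fequiv f g.

Definition oddsupp (A : finType) (n : nat) (a : (A ^ n)%type) : {set A} :=
  [set x : A | odd #|[set i : 'I_n | a i == x]%SET|]%SET.

Definition determined_by_oddsupp (A : finType) (B : Type) (n : nat)
    (f : (A ^ n)%type -> B) : Prop :=
  exists fstar : {set A} -> B, forall a : (A ^ n)%type, f a = fstar (oddsupp a).

(* Main.v *)
(* Every card of f is h(a) = f*(oddsupp of all but one argument of a), so a
   reconstruction g agrees, on the tuples b with b_i = b_j, with the value of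
   f* at oddsupp(b) with b_j and b_l toggled, for some position l depending on
   the pair {i, j}.  If l is in {i, j}, this value is f(b), and since n > |A|
   every b has a repeated entry.  If f is constant, there is nothing to prove.
   Otherwise toggling is detectable, and comparing the expressions for g on
   tuples with two coincidences shows that l outside {i, j} is impossible:
   the pairs {i, j}, {i, m}, {j, m} would all have the same l, while the pair
   {m, l} would have to point to i or j. *)

From mathcomp Require Import boolp classical_sets.
Require Import Defs.

Set Implicit Arguments.
Unset Strict Implicit.
Unset Printing Implicit Defensive.

(** * Parities of multiplicities under updates and permutations *)

Section Parity.
Variables (A : finType) (n : nat).
Implicit Types (b : (A ^ n)%type) (x y : A) (k : 'I_n).

Definition parity b x : bool := \big[addb/false]_(i < n) (b i == x).

Definition upd b k x : (A ^ n)%type := [ffun i => if i == k then x else b i].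

Lemma in_oddsupp b x : (x \in oddsupp b) = parity b x.
Proof.
rewrite inE /parity -sum1dep_card big_mkcond.
rewrite (big_morph odd oddD (erefl _)); apply: eq_bigr => i _.
by case: (b i == x).
Qed.

Lemma upd_id b k : upd b k (b k) = b.
Proof. by apply/ffunP => i; rewrite ffunE; case: eqP => [->|]. Qed.

Lemma parity_upd b k y x :
  parity (upd b k y) x = parity b x (+) (b k == x) (+) (y == x).
Proof.
rewrite /parity (bigD1 k) //= [in RHS](bigD1 k) //= ffunE eqxx.
rewrite (eq_bigr (fun i => b i == x)).
  by case: (b k == x); case: (y == x); case: (\big[_/_]_(_ < _ | _) _).
by move=> i /negPf ik; rewrite ffunE ik.
Qed.

Lemma parity_perm b (s : 'S_n) x : parity (reindex b s) x = parity b x.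
Proof.
rewrite /parity [RHS](reindex_inj (@perm_inj _ s)) /=.
by apply: eq_bigr => i _; rewrite ffunE.
Qed.

End Parity.

(** * Identification minors and members of a deck *)

Lemma lift_delta n (I : pair_of n) (i j k : 'I_n) :
  i < j -> min_pair I = i -> max_pair I = j ->
  lift j (delta I k) = if k == j then i else k.
Proof.
move=> ij mE ME; apply: val_inj; rewrite /= /delta_nat mE ME /bump.
rewrite -val_eqE fun_if /=; case: ltngtP => [kj|kj|_].
- by rewrite leqNgt kj.
- by case: (nat_of_ord k) kj => //= m; rewrite ltnS => ->.
- by rewrite leqNgt ij.
Qed.

Lemma fequiv_refl (A B : Type) m (h : (A ^ m)%type -> B) : fequiv h h.
Proof.
by exists 1%g => a; congr h; apply/ffunP => i; rewrite ffunE perm1.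
Qed.

Lemma deck_minor (A B : Type) n (f g : (A ^ n)%type -> B) (I : pair_of n) :
  deck f = deck g -> exists J : pair_of n, fequiv (minor g I) (minor f J).
Proof.
move=> /eq_seq_msetP/perm_mem/(_ (fclass (minor g I))) fg.
have : fclass (minor g I) \in [seq fclass (minor g J) | J : pair_of n].
  by apply: map_f; rewrite mem_enum.
rewrite -fg => /mapP[J _ IJ]; exists J.
have : fclass (minor f J) (minor f J) by apply: fequiv_refl.
by rewrite -IJ.
Qed.

Lemma noninjective_of_card (A : finType) n (b : (A ^ n)%type) :
  #|A| < n -> exists i j, i != j /\ b i = b j.
Proof.
move=> nA; have /injectivePn[i [j ij bij]] : ~~ injectiveb b.
  by apply: contraTN nA => /injectiveP/leq_card; rewrite card_ord -leqNgt.
by exists i, j.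
Qed.

(* Over the hypotheses [i != j], decides equalities of parities of updated
   tuples, which are identities in the group of booleans under [addb]. *)
Ltac xor_tac :=
  rewrite ?parity_upd ?ffunE;
  repeat match goal with
  | H : is_true (?i != ?j) |- _ =>
      rewrite ?(negPf H) ?[j == i]eq_sym ?(negPf H); clear H
  end;
  rewrite ?eqxx;
  repeat match goal with
  | |- context [parity ?b ?x] => generalize (parity b x) => ?
  | |- context [?y == ?x] => generalize (y == x) => ?
  end;
  repeat match goal with b : bool |- _ => move: b end;
  first [done | by do !case].

Ltac uniq_neq U :=
  rewrite /= !inE !negb_or ?andbT in U;
  repeat match goal with H : is_true (_ && _) |- _ => case/andP: H => ? ? end.

Ltac uniq_goal := by rewrite /= !inE !negb_or; xor_tac.

(** * Where the cards of a reconstruction point *)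

Section Reconstruction.
Variables (A : finType) (B : Type) (n : nat) (f g : (A ^ n)%type -> B).
Implicit Types (b c : (A ^ n)%type) (x y : A) (i j k l m z : 'I_n).

Hypothesis f_parity : forall b c, parity b =1 parity c -> f b = f c.

(* [upd b l (b j)] has the parities of [b] with one copy of [b j] and one copy
   of [b l] deleted: [l] is the position of the fictitious argument of the card
   of [g] at [{i, j}], and [l \in {i, j}] means the identified argument. *)
Definition card_at i j l : Prop :=
  forall b, b i = b j -> g b = f (upd b l (b j)).

Lemma card_atC i j l : card_at i j l -> card_at j i l.
Proof. by move=> ijl b bij; rewrite (ijl b) // bij. Qed.

Lemma card_at_exists i j : deck f = deck g -> i != j -> exists l, card_at i j l.
Proof.
move=> fg; wlog ij : i j / i < j => [hw|_].
  rewrite neq_ltn => /orP[] lt_ij; first by apply: hw; rewrite ?neq_ltn ?lt_ij.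
  by have [|l /card_atC] := hw j i lt_ij; [rewrite neq_ltn lt_ij|exists l].
have IP : #|[set i; j]%SET| == 2 by rewrite cards2 -val_eqE neq_ltn ij.
pose I : pair_of n := Sub [set i; j]%SET IP.
have [i1 [j1 [ij1 /= IE mE ME]]] := pair_ofP I.
have [ii1 jj1] : i = i1 /\ j = j1.
  have := set21 i j; have := set22 i j; rewrite IE !inE.
  case/orP => /eqP jE /orP[] /eqP iE //; move: ij; rewrite iE jE ?ltnn //.
  by rewrite ltnNge ltnW.
subst i1 j1.
have [J [s gf]] := deck_minor I fg.
have [i' [j' [ij' _ mE' ME']]] := pair_ofP J.
(* In the parities of the card of [f] at [J] the argument at [delta J j'] is counted twice and drops
   out; [s] and [lift j] carry its position over to [b]. *)
exists (lift j (s (delta J j'))) => b bij.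
pose a : (A ^ n.-1)%type := [ffun p => b (lift j p)].
have bE : b = reindex a (delta I).
  apply/ffunP => k; rewrite !ffunE (lift_delta _ ij) //.
  by case: eqP => [->|].
rewrite {1}bE -[LHS]/(minor g I a) gf; apply: f_parity => x.
rewrite parity_upd /parity (@bigD1_ord _ _ _ _ j') //.
rewrite [in RHS](@bigD1_ord _ _ _ _ j) //= !ffunE.
rewrite [in RHS](reindex_inj (@perm_inj _ s)) /=.
rewrite (eq_bigr (fun p => b (lift j (s p)) == x)).
  by case: (b _ == x); case: (b j == x); case: (\big[_/_]_(_ < _) _).
move=> p _; rewrite !ffunE; congr (b (lift j (s _)) == x).
apply: (@lift_inj _ j'); rewrite (lift_delta _ ij') //.
by rewrite eq_sym (negPf (neq_lift _ _)).
Qed.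

Lemma perm_extends_triple i j k i' j' k' :
  uniq [:: i; j; k] -> uniq [:: i'; j'; k'] ->
  exists s : 'S_n, [/\ s i = i', s j = j' & s k = k'].
Proof.
rewrite /= !inE !negb_or !andbT => /andP[/andP[ij ik] jk].
case/andP=> /andP[ij' ik'] jk'.
pose s1 := tperm i i'; pose s2 := (s1 * tperm (s1 j) j')%g.
have s1i : s1 i = i' by rewrite tpermL.
have s2j : s2 j = j' by rewrite permM tpermL.
have s2i : s2 i = i'.
  by rewrite permM s1i tpermD // 1?eq_sym // -s1i (inj_eq perm_inj).
exists (s2 * tperm (s2 k) k')%g.
rewrite ![(s2 * _)%g _]permM tpermL s2i s2j; split=> //; apply: tpermD => //.
- by rewrite -s2i (inj_eq perm_inj) eq_sym.
- by rewrite eq_sym.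
- by rewrite -s2j (inj_eq perm_inj) eq_sym.
- by rewrite eq_sym.
Qed.

(* By symmetry of [f], a third entry next to a repeated one may be changed
   freely, so any tuple can be turned into a constant one, and [n > 3] allows
   passing from one constant to another through a tuple with two values. *)
Lemma constant_of_triple i j k : 3 < n -> #|A| < n -> uniq [:: i; j; k] ->
  (forall b x y, f (upd (upd b i (b j)) k x) = f (upd (upd b i (b j)) k y)) ->
  forall b c, f b = f c.
Proof.
move=> n3 nA ijk H.
have move1 u v w b y : uniq [:: u; v; w] -> b u = b v -> f (upd b w y) = f b.
  move=> uvw buv; have [s [si sj sk]] := perm_extends_triple ijk uvw.
  have fs c : f c = f (reindex c s).
    by apply: f_parity => x; rewrite parity_perm.
  have E x : reindex (upd b w x) s
           = upd (upd (reindex b s) i (reindex b s j)) k x.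
    apply/ffunP => p; rewrite !ffunE -sk (inj_eq perm_inj).
    by case: eqP => // _; case: eqP => // ->; rewrite si sj.
  by rewrite -[in RHS](upd_id b w) (fs (upd b w y)) (fs (upd b w _)) !E.
have to_const u v b : u != v -> b u = b v -> f b = f [ffun=> b u].
  (* Induction on the number of entries other than [b u], overwriting one of them by [b u] at a
     time. *)
  move=> uv; have [N] := ubnP #|[set p | b p != b u]%SET|.
  elim: N => // N IH in b *; rewrite ltnS => bN buv.
  have [/existsP[w bw]|] := boolP [exists p, b p != b u]; last first.
    rewrite negb_exists => /forallP bE; congr f; apply/ffunP => p.
    by rewrite ffunE; apply/eqP; have := bE p; rewrite negbK.
  have wu : w != u by apply: contraNneq bw => ->.
  have wv : w != v by apply: contraNneq bw => ->; rewrite buv.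
  have uvw : uniq [:: u; v; w].
    by rewrite /= !inE negb_or uv ![_ == w]eq_sym wu wv.
  rewrite -(move1 u v w b (b u)) // IH.
  - by congr f; apply/ffunP => p; rewrite !ffunE eq_sym (negPf wu).
  - apply: leq_trans bN; apply: proper_card; apply/properP; split.
      apply/fintype.subsetP => p; rewrite !inE !ffunE [u == w]eq_sym (negPf wu).
      by case: ifP => //; rewrite eqxx.
    by exists w; rewrite !inE ?ffunE ?[u == w]eq_sym ?(negPf wu) ?eqxx.
  - by rewrite !ffunE ![_ == w]eq_sym (negPf wu) (negPf wv).
pose o t (tn : t < 4) : 'I_n := Ordinal (leq_trans tn n3).
have cc x y : f [ffun=> x] = f [ffun=> y].
  pose b : (A ^ n)%type := [ffun p : 'I_n => if p < 2 then x else y].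
  have := to_const (@o 0 isT) (@o 1 isT) b isT; rewrite !ffunE => <- //.
  by have := to_const (@o 2 isT) (@o 3 isT) b isT; rewrite !ffunE => ->.
move=> b c; have [[u [v [uv buv]]] [u' [v' [uv' cuv]]]] :=
  (noninjective_of_card b nA, noninjective_of_card c nA).
by rewrite (to_const u v b) // (to_const u' v' c).
Qed.

(* The two updates replace [b i], [b j], [b k] by a single entry, up to parity:
   this is nonconstancy of the cards of [f] in one argument. *)
Hypothesis f_nonconst : forall i j k, uniq [:: i; j; k] ->
  exists b x y, f (upd (upd b i (b j)) k x) <> f (upd (upd b i (b j)) k y).

(** The update in [card_at] overwrites the entry at [l], and [b i = b j] does not involve it. *)
Lemma card_at_dummy i j l b x y : card_at i j l -> uniq [:: i; j; l] ->
  b i = b j -> g (upd b l x) = g (upd b l y).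
Proof.
move=> ijl U bij; uniq_neq U.
rewrite !ijl; first by apply: f_parity => p; xor_tac.
all: by rewrite !ffunE; xor_tac.
Qed.

(** Pointing to [l'] turns values of [f] that vary with the entry at [l] into values of [g], which
    ignore that entry by [card_at_dummy]. The same clash proves [card_at_adjacent] and
    [card_at_disjoint]. *)
Lemma card_at_uniq i j l l' : uniq [:: i; j; l; l'] ->
  card_at i j l -> ~ card_at i j l'.
Proof.
move=> U ijl ijl'; uniq_neq U.
have [|b [x [y]]] := @f_nonconst i l' l; first by uniq_goal.
have E v : f (upd (upd b i (b l')) l v) = g (upd (upd b i (b j)) l v).
  by rewrite ijl'; [apply: f_parity => p|]; xor_tac.
case; rewrite !E; apply: (card_at_dummy x y ijl); [uniq_goal|xor_tac].
Qed.

Lemma card_at_cross i j l m q : uniq [:: i; j; l; m] ->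
  card_at i j l -> card_at m l q -> q \in [:: i; j].
Proof.
move=> U ijl mlq; uniq_neq U; apply: contraT; rewrite !inE negb_or.
case/andP=> qi qj; have [|b [x [y]]] := @f_nonconst i j l; first by uniq_goal.
(* Read through {i, j}, [d v] counts [v] three times, hence once modulo 2; read through {m, l} with
   [q] outside {i, j}, the two copies of [v] cancel. *)
pose d v := upd (upd (upd b i v) j v) l (b m).
have E v : f (upd (upd b i (b j)) l v) = g (d v).
  by rewrite ijl /d; [apply: f_parity => p|]; xor_tac.
case; rewrite !E !(mlq (d _)); first (apply: f_parity => p).
all: by rewrite /d; xor_tac.
Qed.

Lemma card_at_adjacent i j l m q : uniq [:: i; j; l; m] ->
  card_at i j l -> card_at i m q -> q \notin [:: i; j; m].
Proof.
move=> U ijl imq; uniq_neq U; apply/negP; rewrite !inE => qP.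
have [|b [x [y]]] := @f_nonconst i j l; first by uniq_goal.
(* [d v] is constant on {i, j, m}, so the update at [q] does nothing, and three equal entries count
   as one. *)
pose d v := upd (upd (upd b i (b m)) j (b m)) l v.
have E v : f (upd (upd b i (b j)) l v) = g (d v).
  rewrite imq /d; last by xor_tac.
  by apply: f_parity => p; case/or3P: qP => /eqP->; xor_tac.
case; rewrite !E; apply: (card_at_dummy x y ijl); [uniq_goal|xor_tac].
Qed.

Lemma card_at_disjoint i j l m z : uniq [:: i; j; l; m; z] ->
  card_at i j l -> ~ card_at m z i.
Proof.
move=> U ijl mzi; uniq_neq U.
have [|b [x [y]]] := @f_nonconst m i l; first by uniq_goal.
pose d v := upd (upd (upd b m (b z)) i (b j)) l v.
have E v : f (upd (upd b m (b i)) l v) = g (d v).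
  by rewrite mzi /d; [apply: f_parity => p|]; xor_tac.
case; rewrite !E; apply: (card_at_dummy x y ijl); [uniq_goal|xor_tac].
Qed.

Hypothesis card_ex : forall i j, i != j -> exists l, card_at i j l.

Lemma card_at_spread i j l m : uniq [:: i; j; l; m] ->
  card_at i j l -> card_at i m l.
Proof.
move=> U ijl; uniq_neq U.
have [z imz] : exists z, card_at i m z by apply: card_ex.
have [<- //|zl] := eqVneq z l.
have := card_at_adjacent _ ijl imz; rewrite !inE !negb_or => /(_ _)/and3P[].
  by uniq_goal.
(* Now [z] is a fifth index. Crossing with {i, j} and with {i, m} forces {z, l} to point to [i]. *)
move=> zi zj zm; exfalso.
have [q zlq] : exists q, card_at z l q by apply: card_ex.
have qij := card_at_cross (i := i) (j := j) _ ijl zlq.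
have qim := card_at_cross (i := i) (j := m) _ imz (card_atC zlq).
have qi : q = i.
  have := qij ltac:(uniq_goal); have := qim ltac:(uniq_goal); rewrite !inE.
  case/orP=> /eqP-> //; case/orP=> /eqP // /eqP; xor_tac.
move: qi zlq => {q qij qim} -> zli.
(* Here [w] turns out to be a sixth index, and {i, w} would have to point into both {j, m} and {z,
   l}. *)
have [w jmw] : exists w, card_at j m w by apply: card_ex.
have wz : w != z.
  apply/eqP=> wz; subst w; case: (@card_at_disjoint z l i j m) => //.
  by uniq_goal.
have wl : w != l.
  apply/eqP=> wl; subst w; case: (@card_at_disjoint l z i j m) => //.
    by uniq_goal.
  exact: card_atC.
have := card_at_adjacent _ (card_atC ijl) jmw.
rewrite !inE !negb_or => /(_ _)/and3P[]; first by uniq_goal.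
move=> wj wi wm; have [q iwq] : exists q, card_at i w q.
  by apply: card_ex; rewrite eq_sym.
have := card_at_cross (i := j) (j := m) _ jmw iwq.
have := card_at_cross (i := z) (j := l) _ zli (card_atC iwq).
move=> /(_ ltac:(uniq_goal)) + /(_ ltac:(uniq_goal)).
by rewrite !inE => /orP[] /eqP->; xor_tac.
Qed.

Lemma card_at_merged i j l : 3 < n -> i != j -> card_at i j l ->
  l \in [:: i; j].
Proof.
move=> n3 ij ijl; apply: contraT; rewrite !inE negb_or => /andP[li lj].
have [m] : exists m, m \notin [:: i; j; l].
  apply/existsP; rewrite -negb_forall; apply: contraL n3 => /forallP all3.
  rewrite -leqNgt -(card_ord n); apply: leq_trans (card_size [:: i; j; l]).
  by apply: subset_leq_card; apply/fintype.subsetP => p _; apply: all3.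
rewrite !inE !negb_or => /and3P[mi mj ml].
have iml : card_at i m l by apply: card_at_spread ijl; uniq_goal.
have jml : card_at j m l by apply: card_at_spread (card_atC ijl); uniq_goal.
have [q mlq] : exists q, card_at m l q by apply: card_ex.
have := card_at_cross _ ijl mlq; rewrite !inE => /(_ ltac:(uniq_goal)).
(* Spreading from {m, l} makes {m, j} point to [i] as well as [l], or {m, i} to [j] as well as [l],
   against [card_at_uniq]. *)
case/orP=> /eqP qE; subst q.
  have mji : card_at m j i by apply: card_at_spread mlq; uniq_goal.
  by case: (@card_at_uniq j m l i) => //; [uniq_goal|exact: card_atC].
have mij : card_at m i j by apply: card_at_spread mlq; uniq_goal.
by case: (@card_at_uniq i m l j) => //; [uniq_goal|exact: card_atC].
Qed.

End Reconstruction.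

Theorem proposition3p11 (A : finType) (B : Type) (n : nat)
    (hA : 2 <= #|A|) (hB : exists b1 b2 : B, b1 <> b2)
    (f : (A ^ n)%type -> B) (hn : maxn #|A| 3 < n)
    (hf : determined_by_oddsupp f) :
  reconstructible f.
Proof.
move: hn; rewrite gtn_max => /andP[nA n3] g fg.
have [fstar fE] := hf.
have f_parity (b c : (A ^ n)%type) : parity b =1 parity c -> f b = f c.
  move=> bc; rewrite !fE; congr fstar.
  by apply/setP => x; rewrite !in_oddsupp bc.
have card_ex i j : i != j -> exists l, card_at f g i j l.
  exact: card_at_exists.
suff gf b : g b = f b.
  exists 1%g => b; rewrite gf; congr f; apply/ffunP => i.
  by rewrite ffunE perm1.
have [i [j [ij bij]]] : exists i j, i != j /\ b i = b j.
  exact: noninjective_of_card.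
have [l ijl] := card_ex i j ij; rewrite (ijl b bij).
have [f_const|f_nonconst] := EM (forall b c, f b = f c); first exact: f_const.
have : l \in [:: i; j].
  apply: card_at_merged ijl => // u v w uvw; apply: contrapT => H.
  apply: f_nonconst; apply: (constant_of_triple f_parity n3 nA uvw) => c x y.
  by apply: contrapT => cxy; apply: H; exists c, x, y.
by rewrite !inE => /orP[] /eqP->; rewrite ?upd_id // -bij upd_id.
Qed.
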